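(* Let $J:L_1(S)\rightrightarrows L_\infty(S)$ be the normalized duality mapping of the real Banach space $L_1(S)$. Let $f\in L_1^+(S)$ with $f\neq\theta$, and let $f^{**}\in L_\infty(S)^*$ be the functional induced by $f$. Let $f^*\in J(f)$ be defined by $$f^*(s)=\begin{cases}\|f\|_1,&\text{for } f(s)>0,\\ 0,&\text{for } f(s)=0,\end{cases}\qquad\text{for all } s\in S.$$ Then $$-f^*\notin\widehat{D}^*J(f,f^* )(f^{**}).$$
   Context: $(S,\mathcal A,\mu)$ is a positive and complete measure space; it is a standing convention that the real Banach space $(L_1(S),\|\cdot\|_1)$ has dual space $L_1(S)^*=(L_\infty(S),\|\cdot\|_\infty)$ via $\langle k^*,f\rangle=\int_S k^*(s)f(s)\,\mu(ds)$, and that $L_1(S)$ and $L_\infty(S)$ are not reflexive. Pointwise formulas for elements of these spaces are understood up to $\mu$-null sets. $\langle\cdot,\cdot\rangle_*$ is the pairing between $L_\infty(S)^*$ (identified in the paper with a space $ba(S,\mathcal A)$ of bounded finitely additive set functions acting by integration) and $L_\infty(S)$. $\theta$ is the origin of $L_1(S)$. $L_1^+(S)=\{f\in L_1(S): f(s)\ge0\text{ for almost all }s\in S\}$. Each $f\in L_1^+(S)$ induces $f^{**}\in L_\infty(S)^*$, given by the measure $f^{**}(A)=\int_A f\,d\mu$ ($A\in\mathcal A$), i.e. $\langle f^{**},k^*\rangle_*=\langle k^*,f\rangle=\int_S k^*(s)f(s)\,\mu(ds)$ for all $k^*\in L_\infty(S)$. The normalized duality mapping is $J(f)=\{f^*\in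 L_\infty(S):\langle f^*,f\rangle=\|f\|_1^2=\|f^*\|_\infty^2\}$. For $f\in L_1(S)$, $f^*\in J(f)$, the Mordukhovich derivative of $J$ at $(f,f^* )$ is defined, for $\gamma\in L_\infty(S)^*$, by $$\widehat{D}^*J(f,f^* )(\gamma)=\left\{k^*\in L_\infty(S):\ \limsup_{(g,g^* )\to(f,f^* ),\ g\in L_1(S),\ g^*\in J(g)}\frac{\langle k^*,g-f\rangle-\langle\gamma,g^*-f^*\rangle_*}{\|g-f\|_1+\|g^*-f^*\|_\infty}\le0\right\},$$ with convergence in the norms and $(g,g^* )\ne(f,f^* )$. *)

(* Defs.v *)
From HB Require Import structures.
From mathcomp Require Import all_boot all_order all_algebra.
From mathcomp Require Import all_classical all_reals all_analysis.
From mathcomp Require Import ring.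
From mathcomp Require Import ess_sup_inf measurable_realfun.

Set Implicit Arguments.
Unset Strict Implicit.
Unset Printing Implicit Defensive.
Import Order.TTheory GRing.Theory Num.Theory numFieldNormedType.Exports.
Local Open Scope classical_set_scope.
Local Open Scope ring_scope.

(* [LspaceType mu p1] is the library's type of a.e.-equality classes of         *)
(* measurable real functions with finite p-norm; it comes without any algebraic *)
(* structure. It is made here a normed space for the p-norm.                    *)
Section Lspace_normed.
Context d (T : measurableType d) (R : realType).
Variables (mu : {measure set T -> \bar R}) (p : \bar R) (p1 : (1 <= p)%E).
Local Notation Lf := (LfunType mu p1).
Local Notation Lp := (LspaceType mu p1).

HB.instance Definition _ := gen_eqMixin Lp.
HB.instance Definition _ := gen_choiceMixin Lp.

Lemma Lnorm_ae (f g : T -> R) : measurable_fun setT f -> measurable_fun setT g ->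
  f = g %[ae mu] -> ('N[mu]_p[EFin \o f] = 'N[mu]_p[EFin \o g])%E.
Proof.
have mpow r (h : T -> R) : measurable_fun setT h ->
    measurable_fun setT (fun x => `|(EFin \o h) x| `^ r)%E.
  move=> mh; have mh' : measurable_fun setT (fun x => `|(EFin \o h) x|)%E.
    by apply: measurableT_comp => //; exact/measurable_EFinP.
  exact: (measurableT_comp (measurable_poweR r) mh').
move=> mf mg fg; rewrite unlock /Lnorm; case: p p1 => [r r1||//].
- congr (_ `^ _)%E; apply: ae_eq_integral => //; [exact: mpow|exact: mpow|].
  by apply: filterS fg => x /= /[apply] ->.
- move=> _; case: ifPn => // _; apply: eq_ess_sup.
  by apply: filterS fg => x /= /(_ I) ->.
Qed.


(* The library bundles [Lp] over [measurableTypeR R] and [Lf] over [R]: the same *)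
(* measurable sets with different displays.                                      *)
Definition mfun_of_Lfun (f : Lf) : {mfun T >-> measurableTypeR R} :=
  HB.pack (f : T -> measurableTypeR R)
    (@isMeasurableFun.Build _ _ T (measurableTypeR R) f
       (measurable_funPT f : measurable_fun setT (f : T -> measurableTypeR R))).

Lemma Lspace_measurable (u : Lp) : measurable_fun setT (u : T -> R).
Proof.
exact: (measurable_funPT (repr (LebesgueSpace.sort u) :
  {mfun T >-> measurableTypeR R})).
Qed.

Definition mfun_class (f : Lf) : {mfun_ mu, T >-> measurableTypeR R} :=
  (\pi_({mfun_ mu, T >-> measurableTypeR R}) (mfun_of_Lfun f))%qT.

Lemma mfun_classE (f : Lf) : (mfun_class f : T -> R) = f %[ae mu].
Proof.
have : (repr (mfun_class f) =
  mfun_of_Lfun f %[mod {mfun_ mu, T >-> measurableTypeR R}])%qT by rewrite reprK.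
by move/eqP; rewrite eqmodE => /asboolP.
Qed.

Lemma mfun_class_finite_norm (f : Lf) : finite_norm mu p (mfun_class f : T -> R).
Proof.
rewrite /finite_norm (Lnorm_ae _ _ (mfun_classE f)).
- exact: Lfunction_finite.
- exact: (measurable_funPT (repr (mfun_class f) : {mfun T >-> measurableTypeR R})).
- exact: measurable_funPT.
Qed.

Definition Lclass (f : Lf) : Lp :=
  HB.pack (mfun_class f)
    (isFinLebesgue.Build _ _ _ mu p p1 _ (mfun_class_finite_norm f)).

Lemma LclassE (f : Lf) : (Lclass f : T -> R) = f %[ae mu].
Proof. exact: mfun_classE. Qed.

Lemma Lspace_Lfun (u : Lp) : (u : T -> R) \in Lfun mu p.
Proof.
apply/andP; split; rewrite inE/=; first exact: Lspace_measurable.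
exact: Lebesgue_finite.
Qed.

Definition Lrepr (u : Lp) : Lf := Lfun_Sub p1 (Lspace_Lfun u).

Lemma Lspace_eqP (u v : Lp) : u = v <-> (u : T -> R) = v %[ae mu].
Proof.
split=> [->|uv]; first exact: ae_eq_refl.
have : LebesgueSpace.sort u = LebesgueSpace.sort v.
  rewrite -[LHS]reprK -[RHS]reprK; apply/eqP; rewrite eqmodE; exact/asboolP.
case: u v {uv} => [u [[uP]]] [v [[vP]]] /= uv; subst v.
by rewrite (Prop_irrelevance uP vP).
Qed.

Let zero := Lclass 0.
Let add (u v : Lp) := Lclass (Lrepr u + Lrepr v).
Let opp (u : Lp) := Lclass (- Lrepr u).
Let scale (a : R) (u : Lp) := Lclass (a *: Lrepr u).

Let zeroE : \forall x \ae mu, zero x = 0.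
Proof. by have := LclassE 0; apply: filterS => x /(_ I). Qed.
Let addE u v : \forall x \ae mu, add u v x = u x + v x.
Proof. by have := LclassE (Lrepr u + Lrepr v); apply: filterS => x /(_ I). Qed.
Let oppE u : \forall x \ae mu, opp u x = - u x.
Proof. by have := LclassE (- Lrepr u); apply: filterS => x /(_ I). Qed.
Let scaleE a u : \forall x \ae mu, scale a u x = a * u x.
Proof. by have := LclassE (a *: Lrepr u); apply: filterS => x /(_ I). Qed.

Let addA : associative add.
Proof.
move=> u v w; apply/Lspace_eqP; near=> x => /= _.
by rewrite (near (addE u (add v w)) x)// (near (addE v w) x)//
  (near (addE (add u v) w) x)// (near (addE u v) x)// addrA.
Unshelve. all: by end_near. Qed.

Let addC : commutative add.
Proof.
move=> u v; apply/Lspace_eqP; near=> x => /= _.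
by rewrite (near (addE u v) x)// (near (addE v u) x)// addrC.
Unshelve. all: by end_near. Qed.

Let add0 : left_id zero add.
Proof.
move=> u; apply/Lspace_eqP; near=> x => /= _.
by rewrite (near (addE zero u) x)// (near zeroE x)// add0r.
Unshelve. all: by end_near. Qed.

Let addN : left_inverse zero opp add.
Proof.
move=> u; apply/Lspace_eqP; near=> x => /= _.
by rewrite (near (addE (opp u) u) x)// (near (oppE u) x)// (near zeroE x)// addNr.
Unshelve. all: by end_near. Qed.

HB.instance Definition _ := GRing.isZmodule.Build Lp addA addC add0 addN.

Let scaleA a b u : scale a (scale b u) = scale (a * b) u.
Proof.
apply/Lspace_eqP; near=> x => /= _.
by rewrite (near (scaleE a (scale b u)) x)// (near (scaleE b u) x)//
  (near (scaleE (a * b) u) x)// mulrA.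
Unshelve. all: by end_near. Qed.

Let scale1 : left_id 1 scale.
Proof.
move=> u; apply/Lspace_eqP; near=> x => /= _.
by rewrite (near (scaleE 1 u) x)// mul1r.
Unshelve. all: by end_near. Qed.

Let scaleDr : right_distributive scale +%R.
Proof.
move=> a u v; apply/Lspace_eqP; near=> x => /= _.
by rewrite (near (scaleE a (u + v)) x)// (near (addE u v) x)//
  (near (addE (scale a u) (scale a v)) x)// (near (scaleE a u) x)//
  (near (scaleE a v) x)// mulrDr.
Unshelve. all: by end_near. Qed.

Let scaleDl u : {morph scale^~ u : a b / a + b}.
Proof.
move=> a b; apply/Lspace_eqP; near=> x => /= _.
by rewrite (near (scaleE (a + b) u) x)// (near (addE (scale a u) (scale b u)) x)//
  (near (scaleE a u) x)// (near (scaleE b u) x)// mulrDl.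
Unshelve. all: by end_near. Qed.

HB.instance Definition _ :=
  GRing.Zmodule_isLmodule.Build R Lp scaleA scale1 scaleDr scaleDl.

Let norm (u : Lp) : R := fine ('N[mu]_p[EFin \o (u : T -> R)])%E.

Let normE (u : Lp) (f : Lf) : (u : T -> R) = f %[ae mu] ->
  norm u = fine ('N[mu]_p[EFin \o f])%E.
Proof.
move=> uf; congr fine; apply: Lnorm_ae uf; last exact: measurable_funPT.
exact: Lspace_measurable.
Qed.

Let normD u v : norm (u + v) <= norm u + norm v.
Proof. by rewrite (normE (LclassE _)); exact: (ler_LnormD (Lrepr u) (Lrepr v)). Qed.

Let normZ a u : norm (a *: u) = `|a| * norm u.
Proof.
rewrite (normE (LclassE _)).
by have := LnormZ (Lrepr u) a; rewrite -finite_norm_fine => /(congr1 fine) ->.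
Qed.

Let norm0_eq0 u : norm u = 0 -> u = 0.
Proof.
move=> u0'; have u0 := @fine_Lnormr_eq0 _ _ _ _ _ p1 (Lrepr u) u0'; apply/Lspace_eqP.
near=> x => /= _.
rewrite (near zeroE x)//; exact: (near u0 x _ I).
Unshelve. all: by end_near. Qed.

HB.instance Definition _ :=
  Lmodule_isNormed.Build R Lp normD normZ norm0_eq0.

Lemma LspaceDE (u v : Lp) : \forall x \ae mu, (u + v : Lp) x = u x + v x.
Proof. exact: addE. Qed.
Lemma LspaceNE (u : Lp) : \forall x \ae mu, (- u : Lp) x = - u x.
Proof. exact: oppE. Qed.
Lemma LspaceZE a (u : Lp) : \forall x \ae mu, (a *: u : Lp) x = a * u x.
Proof. exact: scaleE. Qed.
Lemma Lspace_normE (u : Lp) : `|u|%:E = ('N[mu]_p[EFin \o (u : T -> R)])%E.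
Proof. exact: (finite_norm_fine (Lrepr u)). Qed.

End Lspace_normed.

Section topological_dual.
Variables (R : realType) (E : normedModType R).

Definition continuous_functional : {pred E -> R^o} :=
  mem [set phi : E -> R^o | linear phi /\ continuous phi].

Record topdual := Dual {
  dual_fun :> E -> R^o;
  dual_funP : dual_fun \in continuous_functional }.

HB.instance Definition _ := [isSub for dual_fun].
HB.instance Definition _ := [Choice of topdual by <:].

Lemma continuous_functional_submod_closed : submod_closed continuous_functional.
Proof.
split=> [|a phi psi].
  rewrite inE/=; split; first by move=> a x y; rewrite /= scaler0 addr0.
  exact: cst_continuous.
rewrite !inE/= => -[lphi cphi] [lpsi cpsi]; split=> [b x y|x].
  by rewrite !fctE lphi lpsi /GRing.scale/=; ring.
by apply: cvgD; [apply: cvgZr; exact: cphi|exact: cpsi].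
Qed.

HB.instance Definition _ := GRing.isSubmodClosed.Build R (E -> R^o)
  continuous_functional continuous_functional_submod_closed.
HB.instance Definition _ := [SubChoice_isSubLmodule of topdual by <:].

Lemma continuous_functionalP (phi : E -> R^o) : linear phi ->
  continuous phi <-> exists C, forall x, `|phi x| <= C * `|x|.
Proof.
move=> lphi.
pose f : {linear E -> R^o} := HB.pack phi (GRing.isLinear.Build _ _ _ _ phi lphi).
split.
  move=> /(linear_bounded_continuous f)/linear_boundedP[M [_ fM]].
  by exists (M + 1) => x; apply: fM; rewrite ltrDl.
move=> [C fC]; apply/(linear_bounded_continuous f)/linear_boundedP.
exists C; split=> [|r Cr x]; first exact: num_real.
by apply: (le_trans (fC x)); rewrite ler_wpM2r// ltW.
Qed.

Definition opnorm (phi : topdual) : R := sup [set `|phi x| | x in [set x | `|x| <= 1]].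

Lemma dual_linear (phi : topdual) : linear phi.
Proof. by have := dual_funP phi; rewrite inE => -[]. Qed.

Lemma dual_continuous (phi : topdual) : continuous phi.
Proof. by have := dual_funP phi; rewrite inE => -[]. Qed.

Let dual0 (phi : topdual) : phi 0 = 0.
Proof. by have := dual_linear phi (-1) 0 0; rewrite scaler0 addr0 scaleN1r addNr. Qed.

Lemma dualZ (phi : topdual) a x : phi (a *: x) = a * phi x.
Proof. by have := dual_linear phi a x 0; rewrite !addr0 dual0 addr0. Qed.

Lemma opnorm_has_sup (phi : topdual) :
  has_sup [set `|phi x| | x in [set x | `|x| <= 1]].
Proof.
have [C phiC] := (continuous_functionalP (@dual_linear phi)).1 (@dual_continuous phi).
split; first by exists `|phi 0|, 0 => //=; rewrite normr0.
exists `|C| => _ [x /= x1 <-]; apply: (le_trans (phiC x)).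
apply: (le_trans (y := `|C| * `|x|)); first by rewrite ler_wpM2r// ler_norm.
by rewrite -[leRHS]mulr1 ler_wpM2l.
Qed.

Lemma le_opnorm (phi : topdual) x : `|phi x| <= opnorm phi * `|x|.
Proof.
have [->|x0] := eqVneq x 0; first by rewrite dual0 !normr0 mulr0.
rewrite -ler_pdivrMr ?normr_gt0//.
apply: (sup_upper_bound (opnorm_has_sup phi)).
exists (`|x|^-1 *: x); first by rewrite /= normrZ normfV normr_id mulVf ?normr_eq0.
by rewrite dualZ normrM normfV normr_id mulrC.
Qed.

Lemma opnorm_le (phi : topdual) C : (forall x, `|x| <= 1 -> `|phi x| <= C) ->
  opnorm phi <= C.
Proof.
move=> phiC; apply: ge_sup; first by have [] := opnorm_has_sup phi.
by move=> _ [x /= /phiC ? <-].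
Qed.

Let opnorm_ge0 (phi : topdual) : 0 <= opnorm phi.
Proof.
apply: (le_trans (normr_ge0 (phi 0))).
apply: (sup_upper_bound (opnorm_has_sup phi)).
by exists 0 => //=; rewrite normr0.
Qed.

Let le_opnorm1 (phi : topdual) x : `|x| <= 1 -> `|phi x| <= opnorm phi.
Proof.
by move=> x1; rewrite (le_trans (le_opnorm phi x))// -[leRHS]mulr1 ler_wpM2l.
Qed.

Let opnormD phi psi : opnorm (phi + psi) <= opnorm phi + opnorm psi.
Proof.
apply: opnorm_le => x x1.
by apply: (le_trans (ler_normD (phi x) (psi x))); rewrite lerD ?le_opnorm1.
Qed.

Let opnormZ a phi : opnorm (a *: phi) = `|a| * opnorm phi.
Proof.
have le_opnormZ b psi : opnorm (b *: psi) <= `|b| * opnorm psi.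
  apply: opnorm_le => x x1.
  rewrite (_ : (b *: psi) x = b * psi x)//.
  by rewrite normrM ler_wpM2l ?le_opnorm1.
apply/eqP; rewrite eq_le le_opnormZ /=.
have [->|a0] := eqVneq a 0; first by rewrite normr0 mul0r.
rewrite -ler_pdivlMl ?normr_gt0// -normfV.
by apply: le_trans (le_opnormZ _ _); rewrite scalerA mulVf// scale1r.
Qed.

Let opnorm_eq0 phi : opnorm phi = 0 -> phi = 0.
Proof.
move=> phi0; apply/val_inj/funext => x /=; apply/eqP.
by rewrite -normr_le0 (le_trans (le_opnorm phi x))// phi0 mul0r.
Qed.

HB.instance Definition _ :=
  Lmodule_isNormed.Build R topdual opnormD opnormZ opnorm_eq0.

End topological_dual.

Section reflexivity.
Variables (R : realType) (E : normedModType R).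

Lemma evaluation_subproof (x : E) :
  (fun phi : topdual E => phi x : R^o) \in @continuous_functional R (topdual E).
Proof.
rewrite inE/=; have lin : linear (fun phi : topdual E => phi x : R^o) by [].
split=> //; apply/(continuous_functionalP lin); exists `|x| => phi.
by rewrite mulrC; exact: le_opnorm.
Qed.

Definition evaluation (x : E) : topdual (topdual E) := Dual (evaluation_subproof x).

Definition reflexive_space : Prop := forall gamma : topdual (topdual E),
  exists x : E, gamma = evaluation x.

End reflexivity.

Section L1_Linfty.
Context d (S : measurableType d) (R : realType).
Variable mu : {measure set S -> \bar R}.

Definition L1 := LspaceType mu (lexx 1%E).
Definition Linfty := LspaceType mu (leey 1%E).
HB.instance Definition _ := NormedModule.on L1.
HB.instance Definition _ := NormedModule.on Linfty.

Definition pairing (k : Linfty) (f : L1) : R := \int[mu]_s (k s * f s).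

Lemma Linfty_bound (k : Linfty) : \forall s \ae mu, `|k s| <= `|k|.
Proof.
have := Lspace_normE k; rewrite unlock /=.
case: ifPn => [mu0 ke|mu0 _].
  have := ess_sup_ge mu (abse \o (EFin \o (k : S -> R))).
  by apply: filterS => s; rewrite -ke /= lee_fin.
exists setT; split => //.
by apply/eqP; rewrite eq_le measure_ge0 andbT leNgt.
Qed.

Lemma L1_norm_integral (f : L1) : `|f|%:E = (\int[mu]_s `|(f s)%:E|)%E.
Proof. by rewrite (Lspace_normE f) Lnorm1. Qed.

Lemma pairing_abs_bound (k : Linfty) (f : L1) :
  (\int[mu]_s `|(k s * f s)%:E| <= (`|k| * `|f|)%:E)%E.
Proof.
have mf := Lspace_measurable f; have mk := Lspace_measurable k.
have mf' : measurable_fun setT (fun s => `|(f s)%:E|%E).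
  by apply: measurableT_comp => //; exact/measurable_EFinP.
rewrite EFinM L1_norm_integral -ge0_integralZl//.
apply: ae_ge0_le_integral => //.
- apply: measurableT_comp => //; apply/measurable_EFinP; exact: measurable_funM.
- apply: measurable_funeM; exact: mf'.
have := Linfty_bound k; apply: filterS => s ks _.
by rewrite /= -EFinM lee_fin normrM ler_wpM2r.
Qed.

Lemma pairing_integrable (k : Linfty) (f : L1) :
  mu.-integrable setT (fun s => (k s * f s)%:E).
Proof.
apply/integrableP; split.
  apply/measurable_EFinP; apply: measurable_funM; exact: Lspace_measurable.
exact: (le_lt_trans (pairing_abs_bound k f) (ltry _)).
Qed.

Lemma pairing_bound (k : Linfty) (f : L1) : `|pairing k f| <= `|k| * `|f|.
Proof.
rewrite -lee_fin EFin_normr_Rintegral//; last exact: pairing_integrable.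
apply: le_trans (pairing_abs_bound k f).
apply: le_abse_integral => //; apply/measurable_EFinP.
by apply: measurable_funM; exact: Lspace_measurable.
Qed.

Let measurable_pairing (k : Linfty) (f : L1) :
  measurable_fun setT (fun s => (k s * f s)%:E).
Proof. by have /integrableP[] := pairing_integrable k f. Qed.

Let pairing_lin (a : R) (k k' k'' : Linfty) (f f' f'' : L1) :
  (\forall s \ae mu, k s * f s = a * (k' s * f' s) + k'' s * f'' s) ->
  pairing k f = a * pairing k' f' + pairing k'' f''.
Proof.
move=> h; rewrite /pairing -RintegralZl//; last exact: pairing_integrable.
have i1 : mu.-integrable setT (fun s => (a * (k' s * f' s))%:E).
  exact: (integrableZl measurableT a (pairing_integrable k' f')).
rewrite -RintegralD//; last exact: pairing_integrable.
congr fine; apply: ae_eq_integral => //.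
- by have /integrableP[] := integrableD measurableT i1 (pairing_integrable k'' f'').
- by apply: filterS h => s -> _.
Qed.

Lemma pairing_linearl (f : L1) : linear (pairing^~ f : Linfty -> R^o).
Proof.
move=> a k k'; apply: pairing_lin; near=> s.
rewrite (near (LspaceDE (a *: k) k') s)// (near (LspaceZE a k) s)//.
by rewrite mulrDl mulrA.
Unshelve. all: by end_near. Qed.

Lemma pairing_linearr (k : Linfty) : linear (pairing k : L1 -> R^o).
Proof.
move=> a f f'; apply: pairing_lin; near=> s.
rewrite (near (LspaceDE (a *: f) f') s)// (near (LspaceZE a f) s)//.
by rewrite mulrDr mulrCA.
Unshelve. all: by end_near. Qed.

Lemma Linfty_functional_subproof (k : Linfty) :
  (pairing k : L1 -> R^o) \in @continuous_functional R L1.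
Proof.
rewrite inE/=; split; first exact: pairing_linearr.
apply/(continuous_functionalP (pairing_linearr k)); exists `|k| => f.
exact: pairing_bound.
Qed.

Lemma L1_bidual_subproof (f : L1) :
  (pairing^~ f : Linfty -> R^o) \in @continuous_functional R Linfty.
Proof.
rewrite inE/=; split; first exact: pairing_linearl.
apply/(continuous_functionalP (pairing_linearl f)); exists `|f| => k.
by rewrite mulrC; exact: pairing_bound.
Qed.

Definition Linfty_functional (k : Linfty) : topdual L1 :=
  Dual (Linfty_functional_subproof k).

(* [f^**] as a functional on [Linfty]: integration against the measure          *)
(* [A |-> \int_A f dmu].                                                         *)
Definition L1_bidual (f : L1) : topdual Linfty := Dual (L1_bidual_subproof f).

Definition dual_L1_is_Linfty : Prop :=
  bijective Linfty_functional /\ forall k, `|Linfty_functional k| = `|k|.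

Definition L1_nonneg : set L1 := [set f | \forall s \ae mu, 0 <= f s].

Definition duality_mapping (f : L1) : set Linfty :=
  [set k | pairing k f = `|f| ^+ 2 /\ `|f| ^+ 2 = `|k| ^+ 2].

(* [_^'] is the filter of punctured neighborhoods for the product of the two    *)
(* norm topologies, so the limsup excludes (f, fs) itself. *)
Definition Mordukhovich_derivative (F : L1 -> set Linfty) (f : L1) (fs : Linfty)
    (gamma : topdual Linfty) : set Linfty :=
  [set k | (limf_esup (fun z : L1 * Linfty =>
      ((pairing k (z.1 - f) - gamma (z.2 - fs)) /
       (`|z.1 - f| + `|z.2 - fs|))%:E)
    (within [set z | F z.1 z.2] (f, fs)^') <= 0)%E].

End L1_Linfty.

(* Main.v *)
Require Import Defs.
From HB Require Import structures.
From mathcomp Require Import all_boot all_order all_algebra.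
From mathcomp Require Import all_classical all_reals all_analysis.
From mathcomp Require Import ring ess_sup_inf measurable_realfun.

Import Order.TTheory GRing.Theory Num.Theory numFieldNormedType.Exports.
Local Open Scope classical_set_scope.
Local Open Scope ring_scope.

(** The duality mapping [J] is positively homogeneous, so its graph contains,
with [(f, f^* )], the whole ray of points [((1 - t) f, (1 - t) f^* )]. Let [t]
decrease to 0 along this ray. Both pairings in the numerator of the
difference quotient for [- f^*] and [f^**] then contribute [t <f^*, f>]:
[[
<- f^*, - t f> - <f^**, - t f^*> = 2 t <f^*, f> = 2 t |f|^2,
]]
while the denominator is [t |f| + t |f^*| = 2 t |f|]. The quotient is thus
constantly [|f| > 0] along the ray, and the upper limit is at least [|f|]
([duality_mapping_not_derivative]).

It remains to see that the given [f^*] is in [J f]. As [f] is nonnegative, the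
formula for [f^*] gives [f^* f = |f| f] almost everywhere, hence
[<f^*, f> = |f|^2]; it also gives [|f^*| <= |f|], and the reverse inequality
follows from [|f|^2 = <f^*, f> <= |f^*| |f|] ([scaled_support_duality_mapping]). *)

(** Every member of [F] contains a point of the curve [c] at which [g] takes the
value [l], so [l] is below each of the suprema whose infimum is the superior
limit. *)
Lemma limf_esup_ge_along (I : Type) (T : choiceType) (X : filteredType T)
    (R : realType) (G : set_system I) (F : set_system X) (c : I -> X)
    (g : X -> \bar R) (l : \bar R) : ProperFilter G -> c @ G `=>` F ->
  (\forall t \near G, g (c t) = l) -> (l <= limf_esup g F)%E.
Proof.
move=> GP cF gl; apply: le_ereal_inf_tmp => _ [V FV <-].
have GV : G (c @^-1` V) := cF _ FV.
have [t [Vt glt]] := filter_ex (filterI GV gl).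
by apply: ereal_sup_ubound; exists (c t).
Qed.

Section duality_mapping.
Context d (S : measurableType d) (R : realType).
Variable mu : {measure set S -> \bar R}.
Implicit Types (f : L1 mu) (k : Linfty mu).

Lemma Linfty_norm_le k (C : R) : 0 <= C ->
  (\forall s \ae mu, `|k s| <= C) -> `|k| <= C.
Proof.
move=> C0 kC; rewrite -lee_fin Lspace_normE unlock /=.
by case: ifPn => // _; apply/ess_supP; apply: filterS kC => s /=; rewrite lee_fin.
Qed.

Lemma pairingZl (a : R) k f : pairing (a *: k) f = a * pairing k f.
Proof. exact: (dualZ (L1_bidual f)). Qed.

Lemma pairingZr (a : R) k f : pairing k (a *: f) = a * pairing k f.
Proof. exact: (dualZ (Linfty_functional k)). Qed.

Lemma pairing_norm k f (a : R) :
  (\forall s \ae mu, k s * f s = a * `|f s|) -> pairing k f = a * `|f|.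
Proof.
move=> kf.
have mf : measurable_fun setT (fun s => `|f s|).
  by apply: measurableT_comp => //; exact: Lspace_measurable.
apply: EFin_inj; rewrite /pairing fineK; last first.
  exact: integrable_fin_num (pairing_integrable k f).
rewrite EFinM L1_norm_integral.
rewrite (ae_eq_integral (fun s => a%:E * `|f s|%:E)%E) //.
- rewrite integralZl//; apply/integrableP; split; first exact/measurable_EFinP.
  under eq_integral do rewrite /= normr_id.
  by rewrite -[ltLHS]/(\int[mu]_s `|(f s)%:E|)%E -L1_norm_integral ltry.
- by have /integrableP[] := pairing_integrable k f.
- by apply: measurable_funeM; exact/measurable_EFinP.
- by apply: filterS kf => s kfs _; rewrite kfs EFinM.
Qed.

Lemma duality_mappingZ (a : R) f k :
  duality_mapping f k -> duality_mapping (a *: f) (a *: k).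
Proof.
move=> [kf nkf]; split; last by rewrite !normrZ !exprMn nkf.
by rewrite pairingZl pairingZr kf normrZ exprMn real_normK ?num_real//; ring.
Qed.

Lemma duality_mapping_norm f k : duality_mapping f k -> `|k| = `|f|.
Proof.
by move=> [_ /eqP]; rewrite eqrXn2// => /eqP.
Qed.

Lemma scaled_support_duality_mapping f k : L1_nonneg f ->
  (\forall s \ae mu, (0 < f s -> k s = `|f|) /\ (f s = 0 -> k s = 0)) ->
  duality_mapping f k.
Proof.
move=> f0 kE.
have kf : pairing k f = `|f| ^+ 2.
  rewrite expr2; apply: pairing_norm; apply: filterS2 f0 kE => s fs0 [kpos kzero].
  move: (fs0); rewrite le_eqVlt => /orP[/eqP/esym fs_eq0|fs_gt0].
    by rewrite kzero// fs_eq0 normr0 mul0r mulr0.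
  by rewrite kpos// ger0_norm.
split=> //; congr (_ ^+ 2); apply/eqP; rewrite eq_le; apply/andP; split.
- have [->|fN0] := eqVneq f 0; first by rewrite normr0.
  have := pairing_bound k f.
  by rewrite kf ger0_norm ?sqr_ge0// expr2 ler_pM2r// normr_gt0.
- apply: Linfty_norm_le => //; apply: filterS2 f0 kE => s fs0 [kpos kzero].
  move: fs0; rewrite le_eqVlt => /orP[/eqP/esym fs_eq0|fs_gt0].
    by rewrite kzero// normr0.
  by rewrite kpos// normr_id.
Qed.

(** The points [((1 - t) f, (1 - t) k)] approach [(f, k)] inside the graph of
the duality mapping, by homogeneity, and never reach it because [f] is not
zero. *)
Lemma duality_mapping_ray f k : f <> 0 -> duality_mapping f k ->
  ((1 - t) *: f, (1 - t) *: k) @[t --> (0 : R)^'+] `=>`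
    within [set z | duality_mapping z.1 z.2] (f, k)^'.
Proof.
move=> fN0 Jfk V.
have cvg1 : 1 - t @[t --> (0 : R)^'+] --> (1 : R).
  have : 1 - t @[t --> (0 : R)] --> (1 - 0 : R).
    by apply: cvgB; [exact: cvg_cst|exact: cvg_id].
  by rewrite subr0; exact: cvg_at_right_filter.
have cvgf : (1 - t) *: f @[t --> (0 : R)^'+] --> f.
  by rewrite -[X in _ --> X]scale1r; exact: cvgZr_tmp.
have cvgk : (1 - t) *: k @[t --> (0 : R)^'+] --> k.
  by rewrite -[X in _ --> X]scale1r; exact: cvgZr_tmp.
have cvgfk : ((1 - t) *: f, (1 - t) *: k) @[t --> (0 : R)^'+] --> (f, k).
  exact: (cvg_pair (G := nbhs f) (H := nbhs k) cvgf cvgk).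
rewrite /within /dnbhs /= => nV.
have {}nV : \forall t \near (0 : R)^'+, ((1 - t) *: f, (1 - t) *: k) != (f, k) ->
    duality_mapping ((1 - t) *: f) ((1 - t) *: k) ->
    V ((1 - t) *: f, (1 - t) *: k) := cvgfk _ nV.
apply: filterS2 nV (nbhs_right_gt 0) => t Vt t0.
apply: Vt; last exact: duality_mappingZ.
apply/eqP => -[/eqP]; rewrite -subr_eq0 -[X in _ - X]scale1r -scalerBl.
by rewrite addrAC subrr add0r scaler_eq0 oppr_eq0 (gt_eqF t0)/= => /eqP.
Qed.

(** Along the ray of [duality_mapping_ray] the quotient is constant, equal to
[`|f|]: the minus sign in [- k] turns the difference of the two pairings into
a sum of two equal positive terms. *)
Lemma duality_mapping_not_derivative f k : f <> 0 -> duality_mapping f k ->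
  ~ Mordukhovich_derivative (@duality_mapping d S R mu) f k (L1_bidual f) (- k).
Proof.
move=> fN0 Jfk; rewrite /Mordukhovich_derivative/=; apply/negP; rewrite -ltNge.
have f_gt0 : 0 < `|f| by rewrite normr_gt0; exact/eqP.
apply: (@lt_le_trans _ _ `|f|%:E); first by rewrite lte_fin.
apply: limf_esup_ge_along (duality_mapping_ray f k fN0 Jfk) _.
apply: filterS (nbhs_right_gt 0) => t t0 /=; congr EFin.
have incr (E : lmodType R) (x : E) : (1 - t) *: x - x = (- t) *: x.
  by rewrite -[X in _ - X]scale1r -scalerBl addrAC subrr add0r.
rewrite !incr -[- k]scaleN1r pairingZl pairingZr [X in _ - X](pairingZl (- t) k f).
rewrite Jfk.1 !normrZ (duality_mapping_norm f k Jfk) normrN (gtr0_norm t0).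
by field; rewrite gt_eqF// addr_gt0// mulr_gt0.
Qed.

End duality_mapping.

Theorem theorem4p7 (R : realType) (d : measure_display) (S : measurableType d)
    (mu : {measure set S -> \bar R})
    (mu_complete : measure_is_complete mu)
    (L1_dual : dual_L1_is_Linfty mu)
    (L1_nonreflexive : ~ reflexive_space (L1 mu))
    (Linfty_nonreflexive : ~ reflexive_space (Linfty mu))
    (f : L1 mu) (f_nonneg : L1_nonneg f) (f_neq0 : f <> 0)
    (fs : Linfty mu)
    (fsE : \forall s \ae mu, (0 < f s -> fs s = `|f|) /\ (f s = 0 -> fs s = 0)) :
  ~ Mordukhovich_derivative (@duality_mapping d S R mu) f fs (L1_bidual f) (- fs).
Proof.
apply: duality_mapping_not_derivative => //.
exact: scaled_support_duality_mapping.
Qed.
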